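(* Let $k\ge 2$ be an integer and let $q\neq 2$ be a prime. Let $\mathcal{G}=\langle r,s : s^{2}=r^{2^kq}=e,\ srs^{-1}=r^{2^{k-1}q-1}\rangle$ (a split metacyclic group of order $2^{k+1}q$). Then the power graph of $\mathcal{G}$ is the joined union $$P(\mathcal{G})\cong \Gamma\big[K_1,K_1,K_{\phi(2^kq)},K_{\phi(2^{k-1}q)},\ldots,K_{\phi(2q)},K_{\phi(q)},K_{\phi(2^2)},K_{\phi(2^3)},\ldots,K_{\phi(2^k)},\underbrace{K_2,\ldots,K_2}_{2^{k-2}q},\overline{K}_{2^{k-1}q}\big],$$ where $\Gamma$ is the simple graph with the following vertices (listed in the same order as the graphs above): $u_1$, $u_2$; $a_k,a_{k-1},\ldots,a_1$ (with $a_i$ corresponding to $K_{\phi(2^iq)}$); $c$ (corresponding to $K_{\phi(q)}$); $b_2,b_3,\ldots,b_k$ (with $b_i$ corresponding to $K_{\phi(2^i)}$); $w_1,\ldots,w_{2^{k-2}q}$ (corresponding to the copies of $K_2$); and $z$ (corresponding to $\overline{K}_{2^{k-1}q}$). The edges of $\Gamma$ are exactly the following: $u_1$ is adjacent to every other vertex; $u_2$ is adjacent to all $a_i$, all $b_i$ and all $w_j$ (and to $u_1$); any two distinct $a_i,a_j$ are adjacent; $c$ is adjacent to every $a_i$ (and to $u_1$); any two distinct $b_i,b_j$ are adjacent; and $a_i$ is adjacent to $b_j$ if and only if $j\le i$.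
   Context: The power graph $P(\Omega)$ of a group $\Omega$ is the simple graph with vertex set $\Omega$ in which two distinct elements $u,v$ are adjacent iff $u=v^m$ or $v=u^n$ for some positive integers $m,n$. $K_n$ is the complete graph on $n$ vertices, $\overline{K}_n$ the graph on $n$ vertices with no edges, and $\phi$ is Euler's totient function. For a graph $\Gamma$ with vertices $v_1,\dots,v_n$ and graphs $\Gamma_1,\dots,\Gamma_n$, the joined union $\Gamma[\Gamma_1,\dots,\Gamma_n]$ is the graph obtained from the disjoint union of $\Gamma_1,\dots,\Gamma_n$ by joining every vertex of $\Gamma_i$ to every vertex of $\Gamma_j$ whenever $v_i$ and $v_j$ are adjacent in $\Gamma$. *)

(* Defs.v *)
From HB Require Import structures.
From mathcomp Require Import all_boot all_fingroup.

Set Implicit Arguments.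
Unset Strict Implicit.
Unset Printing Implicit Defensive.

Record graph := Graph {
  vertex : eqType;
  adj : vertex -> vertex -> Prop;
  adj_sym : forall x y, adj x y -> adj y x;
  adj_irrefl : forall x, ~ adj x x }.

Arguments Graph : clear implicits.

Definition graph_iso (A B : graph) : Prop :=
  exists2 f : vertex A -> vertex B,
    bijective f & forall x y, adj x y <-> adj (f x) (f y).

Section PowerGraph.

Variable gT : groupType.

Local Open Scope group_scope.

Definition power_adj (u v : gT) : Prop :=
  u <> v /\
  ((exists2 m : nat, (0 < m)%N & u = v ^+ m) \/
   (exists2 n : nat, (0 < n)%N & v = u ^+ n)).

Lemma power_adj_sym u v : power_adj u v -> power_adj v u.
Proof.
case=> uv e; split; first by move=> vu; apply: uv.
by case: e; [right | left].
Qed.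

Lemma power_adj_irrefl u : ~ power_adj u u.
Proof. by case. Qed.

Definition power_graph : graph :=
  Graph gT power_adj power_adj_sym power_adj_irrefl.

End PowerGraph.

Section CompleteEmpty.

Variable n : nat.

Definition complete_adj (i j : 'I_n) : Prop := i <> j.

Lemma complete_adj_sym i j : complete_adj i j -> complete_adj j i.
Proof. by move=> ij ji; apply: ij. Qed.

Lemma complete_adj_irrefl i : ~ complete_adj i i.
Proof. by apply. Qed.

Definition complete_graph : graph :=
  Graph 'I_n complete_adj complete_adj_sym complete_adj_irrefl.

Definition empty_graph : graph :=
  Graph 'I_n (fun _ _ => False) (fun _ _ => id) (fun _ => id).

End CompleteEmpty.

Section JoinedUnion.

Variables (Gamma : graph) (Gs : vertex Gamma -> graph).

Definition joined_vertex : eqType := {v : vertex Gamma & vertex (Gs v)}.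

(* When [tag x = tag y], [tagged_as x y] is the second component of [y]
   transported to the vertex type of [x]. *)
Definition joined_adj (x y : joined_vertex) : Prop :=
  if tag x == tag y then adj (tagged x) (tagged_as x y)
  else adj (tag x) (tag y).

Lemma joined_adj_sym x y : joined_adj x y -> joined_adj y x.
Proof.
case: x y => [v x] [w y]; rewrite /joined_adj /= eq_sym.
case: eqP => [e | _]; last exact: adj_sym.
by case: v / e x => x; rewrite !tagged_asE; apply: adj_sym.
Qed.

Lemma joined_adj_irrefl x : ~ joined_adj x x.
Proof.
by case: x => v x; rewrite /joined_adj /= eqxx tagged_asE; apply: adj_irrefl.
Qed.

Definition joined_union : graph :=
  Graph joined_vertex joined_adj joined_adj_sym joined_adj_irrefl.

End JoinedUnion.

Section Gamma.

Variables k q : nat.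

Inductive gamma_vertex : Type :=
  | gu1
  | gu2
  | ga i of 1 <= i <= k
  | gc
  | gb i of 2 <= i <= k
  | gw j of 1 <= j <= 2 ^ (k - 2) * q
  | gz.

Definition gamma_code (x : gamma_vertex) : nat * nat :=
  match x with
  | gu1 => (0, 0)
  | gu2 => (1, 0)
  | ga i _ => (2, i)
  | gc => (3, 0)
  | gb i _ => (4, i)
  | gw j _ => (5, j)
  | gz => (6, 0)
  end.

Lemma gamma_code_inj : injective gamma_code.
Proof.
by case=> [||i hi||i hi|i hi|] [||j hj||j hj|j hj|] //= [e];
   move: hj; rewrite -e => hj; rewrite (bool_irrelevance hi hj).
Qed.

HB.instance Definition _ := Equality.copy gamma_vertex (inj_type gamma_code_inj).

(* Each edge is listed here in one orientation; [gamma_adj] symmetrizes. *)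
Definition gamma_edge (x y : gamma_vertex) : bool :=
  match x, y with
  | gu1, gu1 => false
  | gu1, _ => true
  | gu2, ga _ _ | gu2, gb _ _ | gu2, gw _ _ => true
  | ga i _, ga j _ => i != j
  | gc, ga _ _ => true
  | gb i _, gb j _ => i != j
  | ga i _, gb j _ => j <= i
  | _, _ => false
  end.

Definition gamma_adj (x y : gamma_vertex) : Prop :=
  gamma_edge x y || gamma_edge y x.

Lemma gamma_adj_sym x y : gamma_adj x y -> gamma_adj y x.
Proof. by rewrite /gamma_adj orbC. Qed.

Lemma gamma_adj_irrefl x : ~ gamma_adj x x.
Proof. by rewrite /gamma_adj orbb; case: x => //= i _; rewrite eqxx. Qed.

Definition Gamma : graph :=
  Graph gamma_vertex gamma_adj gamma_adj_sym gamma_adj_irrefl.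

Definition gamma_blocks (x : vertex Gamma) : graph :=
  match x with
  | gu1 => complete_graph 1
  | gu2 => complete_graph 1
  | ga i _ => complete_graph (totient (2 ^ i * q))
  | gc => complete_graph (totient q)
  | gb i _ => complete_graph (totient (2 ^ i))
  | gw _ _ => complete_graph 2
  | gz => empty_graph (2 ^ (k - 1) * q)
  end.

End Gamma.

(* Main.v *)
Require Import Defs.
From mathcomp Require Import all_boot all_fingroup.
From mathcomp Require Import cyclic extremal zmodp zify.

(** The relations force every element to be r^i or r^i s, and a semidirect
    product of cyclic groups of orders N = 2^k q and 2 satisfies them, so no
    further collapse occurs: r has order N and s is not a power of r
    ([split_metacyclic_generators]). The semidirect product exists because
    N/2 is even, so that (N/2 - 1)^2 = 1 mod N ([half_pred_sqr]).

    Two elements of a finite group are adjacent in the power graph exactly when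
    one lies in the cyclic group generated by the other. Inside <r> this is
    comparability of the orders for divisibility, because a cyclic group has
    one subgroup for each divisor of its order. Outside <r>, the square of
    r^i s is r^(iN/2), that is 1 for even i and the involution r^(N/2) for odd
    i. Hence such an element y generates {1, y} or {1, y, r^(N/2), y^-1}: the
    only element outside <r> that it can be adjacent to is its inverse, and an
    x in <r> lies in <y> if and only if the order of x divides that of y^2.

    Partition the group accordingly: the elements of <r> by their order
    2^a q^b, the r^i s with i odd into pairs {y, y^-1}, and the r^i s with i
    even into one class of involutions. To each class attach the exponents
    (a, b) of that order, or of the order of y^2 outside <r>. Then the
    members of two different classes are adjacent if and only if one class
    lies in <r> and has exponents below those of the other
    ([mem_cycle_across]), and an inspection of the seven kinds of vertices
    shows that this is the given edge relation ([gamma_adj_below]). Each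
    class induces a complete graph, except the class of involutions outside
    <r>, which induces an empty one ([power_adj_within]); the classes have
    the announced sizes ([card_gamma_fiber]). A graph partitioned in this way
    is the joined union of its classes ([joined_union_of_fibers]). *)

Set Implicit Arguments.
Unset Strict Implicit.
Unset Printing Implicit Defensive.

(** * Recognizing a joined union *)

(** The coordinates are given with their inverses, rather than as bijections in
    [Prop], so that the inverse of the isomorphism can be defined without
    choosing over the possibly infinite vertex set of [Gam]. *)
Lemma joined_union_iso (G Gam : graph) (Gs : vertex Gam -> graph)
    (cls : vertex G -> vertex Gam)
    (coord : forall v, {x | cls x == v} -> vertex (Gs v))
    (point : forall v, vertex (Gs v) -> {x | cls x == v}) :
    (forall v, cancel (coord v) (point v)) ->
    (forall v, cancel (point v) (coord v)) ->
    (forall v x y, adj (val x) (val y) <-> adj (coord v x) (coord v y)) ->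
    (forall x y, cls x != cls y -> adj x y <-> adj (cls x) (cls y)) ->
  graph_iso G (joined_union Gs).
Proof.
move=> coordK pointK within across.
pose f (x : vertex G) : vertex (joined_union Gs) :=
  existT (fun v => vertex (Gs v)) (cls x)
    (coord (cls x) (exist _ x (eqxx (cls x)))).
have fE v (x : {x | cls x == v}) : f (val x) = existT _ v (coord v x).
  case: x => x /= xv; have e := eqP xv; case: v / e xv => xv.
  by rewrite /f (bool_irrelevance xv (eqxx _)).
exists f.
  exists (fun u => val (point (tag u) (tagged u))) => [x | [v i]] /=.
    by rewrite coordK.
  by rewrite fE pointK.
move=> x y; rewrite [adj (f x) (f y)]/= /joined_adj /=.
case: eqP => [xy | /eqP xy]; last exact: across.
pose y' : {z | cls z == cls x} := exist _ y (introT eqP (esym xy)).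
rewrite (fE _ y') tagged_asE; exact: (within (cls x) (exist _ x _) y').
Qed.

(** For complete and empty blocks the enumeration of each fiber serves as its
    coordinate system: any bijection respects these adjacencies. *)
Lemma joined_union_of_fibers (T : finType) (R : T -> T -> Prop) symR irrR
    (Gam : graph) (Gs : vertex Gam -> graph)
    (n : vertex Gam -> nat) (full : pred (vertex Gam))
    (F : vertex Gam -> {set T}) :
    (forall v, Gs v = if full v then complete_graph (n v)
                      else empty_graph (n v)) ->
    (forall v, #|F v| = n v) ->
    (forall x, exists v, x \in F v) ->
    (forall v w x, x \in F v -> x \in F w -> v = w) ->
    (forall v, {in F v &, forall x y, R x y <-> full v && (x != y)}) ->
    (forall v w, v != w -> {in F v & F w, forall x y, R x y <-> adj v w}) ->
  graph_iso (Graph T R symR irrR) (joined_union Gs).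
Proof.
move=> GsE cardF coverF disjF within across.
have [cls clsP] := fin_all_exists coverF.
have fiberE v x : (cls x == v) = (x \in F v).
  by apply/eqP/idP => [<- | /(disjF _ _ _ (clsP x))].
have block v : {h : ({x | cls x == v} -> vertex (Gs v)) *
                    (vertex (Gs v) -> {x | cls x == v}) |
    [/\ cancel h.1 h.2, cancel h.2 h.1 &
        forall x y, R (val x) (val y) <-> adj (h.1 x) (h.1 y)]}.
  have cardv : #|{: {x | cls x == v}}| = n v.
    by rewrite card_sig -cardF; apply: eq_card => x; rewrite !inE fiberE.
  have Rv (x y : {x | cls x == v}) :
      R (val x) (val y) <-> full v && (x != y).
    by apply: within; rewrite -fiberE; [apply: (valP x) | apply: (valP y)].
  pose g x := cast_ord cardv (enum_rank x).
  pose h i := enum_val (cast_ord (esym cardv) i).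
  have gK : cancel g h by move=> x; rewrite /g /h cast_ordK enum_rankK.
  have hK : cancel h g by move=> x; rewrite /g /h enum_valK cast_ordKV.
  rewrite GsE; case: (full v) Rv => Rv; exists (g, h); split=> //= x y.
    split=> [/Rv/eqP xy /(can_inj gK) // | gxy].
    by apply/Rv/eqP => xy; apply: gxy; rewrite xy.
  by split=> // /Rv.
apply: (@joined_union_iso (Graph T R symR irrR) _ _ cls
  (fun v => (sval (block v)).1) (fun v => (sval (block v)).2)).
- by move=> v; case: (svalP (block v)).
- by move=> v; case: (svalP (block v)).
- by move=> v; case: (svalP (block v)).
by move=> x y xy; apply: across.
Qed.

(** * Arithmetic of the group order *)

Lemma half_pred_sqr k q : 2 <= k -> 0 < q ->
  (2 ^ (k - 1) * q - 1) * (2 ^ (k - 1) * q - 1) = 1 %[mod 2 ^ k * q].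
Proof.
move=> k2 q0; have -> : k = (k - 2).+2 by lia.
have e0 : 0 < 2 ^ (k - 2) by rewrite expn_gt0.
rewrite subn1 /= !expnS; move: (2 ^ (k - 2)) e0 => u e0.
have -> : (2 * u * q).-1 * (2 * u * q).-1 =
          (u * q - 1) * (2 * (2 * u) * q) + 1 by nia.
by rewrite modnMDl.
Qed.

Section TwoPowers.

Variable q : nat.
Hypotheses (q_pr : prime q) (q2 : q != 2).

Let q_gt0 : 0 < q := prime_gt0 q_pr.

Lemma logn_2q a b : (logn 2 (2 ^ a * q ^ b) = a) * (logn q (2 ^ a * q ^ b) = b).
Proof.
have [q_2 n2q] : logn 2 q = 0 /\ logn q 2 = 0.
  by rewrite !logn_prime // eq_sym (negbTE q2).
rewrite !lognM ?expn_gt0 ?q_gt0 // !lognX q_2 n2q !logn_prime // !eqxx.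
by rewrite !muln0 !muln1 addn0.
Qed.

(** Turns divisibility of orders into the componentwise order of exponents. *)
Lemma dvdn_2q a b c d :
  (2 ^ a * q ^ b %| 2 ^ c * q ^ d) = (a <= c) && (b <= d).
Proof.
apply/idP/andP=> [ab_cd | [ac bd]]; last by rewrite dvdn_mul ?dvdn_exp2l.
have cd_gt0 : 0 < 2 ^ c * q ^ d by rewrite muln_gt0 !expn_gt0 q_gt0.
have le_log p : logn p (2 ^ a * q ^ b) <= logn p (2 ^ c * q ^ d).
  exact: dvdn_leq_log.
by split; [have := le_log 2 | have := le_log q]; rewrite !logn_2q.
Qed.

Lemma divisor_2q d k :
  d %| 2 ^ k * q -> exists a b, [/\ a <= k, b <= 1 & d = 2 ^ a * q ^ b]%N.
Proof.
have [/dvdnP[c ->] | q'd] := boolP (q %| d).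
  rewrite dvdn_pmul2r // => /(dvdn_pfactor _ _ (isT : prime 2))[a ak ->].
  by exists a, 1%N.
rewrite Gauss_dvdl; last by rewrite coprime_sym prime_coprime.
case/(dvdn_pfactor _ _ (isT : prime 2))=> a ak ->.
by exists a, 0; rewrite muln1.
Qed.

End TwoPowers.

(** * The combinatorics of the quotient graph *)

Section Classes.

Variables k q : nat.

(** The vertices whose class is contained in <r>. *)
Definition gamma_rot (v : vertex (Gamma k q)) : bool :=
  match v with gw _ _ | gz => false | _ => true end.

(** The exponents (a, b) such that 2^a q^b is the order of the members of the
    class, or the order of their squares if [gamma_rot] fails. For a member y
    outside <r>, it is <y^2> rather than <y> that decides which elements of
    <r> are powers of y. *)
Definition gamma_lev (v : vertex (Gamma k q)) : nat * nat :=
  match v with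
  | gu1 => (0, 0)
  | gu2 => (1, 0)
  | ga i _ => (i, 1)
  | gc => (0, 1)
  | gb i _ => (i, 0)
  | gw _ _ => (1, 0)
  | gz => (0, 0)
  end.

Definition gamma_below (v w : vertex (Gamma k q)) : bool :=
  [&& gamma_rot v, (gamma_lev v).1 <= (gamma_lev w).1
                 & (gamma_lev v).2 <= (gamma_lev w).2].

(** The edge list of [Gamma], written as a single comparability relation. *)
Lemma gamma_adj_below v w :
  v != w -> gamma_adj v w = gamma_below v w || gamma_below w v.
Proof.
rewrite -(inj_eq (@gamma_code_inj k q)) /gamma_adj /gamma_below.
by case: v w => [||i hi||i hi|i hi|] [||j hj||j hj|j hj|] vw /=;
   congr is_true; rewrite /= ?xpair_eqE in vw *; lia.
Qed.

Lemma gamma_rot_inj v w :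
  gamma_rot v -> gamma_rot w -> gamma_lev v = gamma_lev w -> v = w.
Proof.
case: v w => [||i hi||i hi|i hi|] [||j hj||j hj|j hj|] //= _ _ [] e;
  try (exfalso; lia); by apply: gamma_code_inj; rewrite /= e.
Qed.

Lemma gamma_rot_surj a b : a <= k -> b <= 1 ->
  exists2 v, gamma_rot v & gamma_lev v = (a, b).
Proof.
case: b => [|[|//]] ak _.
  case: a ak => [|[|a]] ak; [by exists (gu1 k q) | by exists (gu2 k q) |].
  by exists (@gb k q a.+2 ak).
case: a ak => [|a] ak; first by exists (gc k q).
by exists (@ga k q a.+1 ak).
Qed.

Definition gamma_size v : nat :=
  if gamma_rot v then totient (2 ^ (gamma_lev v).1 * q ^ (gamma_lev v).2)
  else if v is gz then 2 ^ (k - 1) * q else 2.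

Definition gamma_full (v : vertex (Gamma k q)) : bool :=
  if v is gz then false else true.

(** For [gu1] and [gu2] this uses that 1 and 2 have totient 1. *)
Lemma gamma_blocksE v :
  gamma_blocks v = if gamma_full v then complete_graph (gamma_size v)
                   else empty_graph (gamma_size v).
Proof.
by case: v => [||i hi||i hi|i hi|] //=; rewrite /gamma_size /= ?muln1 ?mul1n.
Qed.

End Classes.

Local Open Scope group_scope.

(** * Powers in finite groups *)

(** Adding the order of the base to an exponent makes it positive without
    changing the power. *)
Lemma power_adjE (gT : finGroupType) (x y : gT) :
  power_adj x y <-> x <> y /\ (x \in <[y]> \/ y \in <[x]>).
Proof.
have powE (u v : gT) : (exists2 m, (0 < m)%N & u = v ^+ m) <-> u \in <[v]>.
  split=> [[m _ ->] | /cycleP[m ->]]; first exact: mem_cycle.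
  exists (m + #[v])%N; first by rewrite addn_gt0 order_gt0 orbT.
  by rewrite expgD expg_order mulg1.
by split=> -[xy [/powE | /powE] yx]; split=> //; (try by left); right.
Qed.

Lemma mem_cycle_dvd (gT : finGroupType) (H : {group gT}) (x y : gT) :
  cyclic H -> x \in H -> y \in H -> (x \in <[y]>) = (#[x] %| #[y]).
Proof.
by move=> cycH Hx Hy; rewrite (cardSg_cyclic cycH) ?cycle_subG.
Qed.

(** The elements of order d in a cyclic group are the generators of its unique
    subgroup of order d. *)
Lemma card_order_cycle (gT : finGroupType) (r : gT) d :
  d %| #[r] -> #|[set x in <[r]> | #[x] == d]| = totient d.
Proof.
move=> d_r; have d_gt0 := dvdn_gt0 (order_gt0 r) d_r.
pose a := r ^+ (#[r] %/ d).
have oa : #[a] = d.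
  by rewrite orderXdiv ?dvdn_div // divnA // mulKn ?order_gt0.
have ra : a \in <[r]> by apply: mem_cycle.
rewrite -{2}oa totient_gen; apply: eq_card => x; rewrite !inE /generator.
apply/andP/eqP => [[rx /eqP ox] | ax].
  apply/eqP; rewrite (eq_subG_cyclic (cycle_cyclic r)) ?cycle_subG //.
  by rewrite -!orderE oa ox.
have -> : #[x] = d by rewrite orderE -ax -orderE.
by rewrite eqxx -(cycle_subG x) -ax cycle_subG.
Qed.

(** The powers of an element x outside H with x^2 in H alternate between the
    complement of H and H, as in a group where H has index two. *)
Section IndexTwo.

Variables (gT : finGroupType) (H : {group gT}).

Lemma mem_expg_notin (x : gT) n :
  x \notin H -> x ^+ 2 \in H -> (x ^+ n \in H) = ~~ odd n.
Proof.
move=> Hx Hx2; rewrite -{1}(odd_double_half n) -mul2n expgD expgM.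
rewrite groupMr; last exact: groupX.
by case: odd; rewrite ?expg1 ?(negbTE Hx) // group1.
Qed.

Lemma mem_cycle_sqr (x y : gT) :
  x \in H -> y \notin H -> y ^+ 2 \in H -> (x \in <[y]>) = (x \in <[y ^+ 2]>).
Proof.
move=> Hx Hy Hy2; apply/idP/idP; last first.
  by move=> xy2; apply: subsetP xy2; rewrite cycle_subG mem_cycle.
case/cycleP=> n def_x; move: Hx; rewrite def_x mem_expg_notin // => n_even.
by rewrite -(even_halfK n_even) -mul2n expgM mem_cycle.
Qed.

(** If y^4 = 1, the odd powers of y are y and y^3 = y^-1. *)
Lemma mem_cycle_odd (x y : gT) :
  y \notin H -> y ^+ 2 \in H -> y ^+ 4 = 1 -> x \notin H ->
  (x \in <[y]>) = (x == y) || (x == y^-1).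
Proof.
move=> Hy Hy2 y4 Hx; apply/idP/idP; last first.
  by case/orP=> /eqP->; rewrite ?groupV cycle_id.
have yV : y^-1 = y ^+ 3.
  by apply: (mulgI y); rewrite mulgV -expgS y4.
case/cycleP=> n def_x; move: Hx; rewrite def_x mem_expg_notin // negbK.
move=> n_odd; rewrite (divn_eq n 4) mulnC expgD expgM y4 expg1n mul1g.
have : n %% 4 < 4 by rewrite ltn_pmod.
have : odd (n %% 4) by rewrite (divn_eq n 4) oddD oddM andbF in n_odd.
rewrite yV; case: (n %% 4) => [|[|[|[|]]]] //= _ _;
by rewrite ?expg1 eqxx ?orbT.
Qed.

End IndexTwo.

(** * Elements outside the cyclic subgroup *)

Section NonRotations.

Variables (gT : finGroupType) (M : nat) (r s : gT).
Hypotheses (or : #[r] = (2 * M)%N) (evenM : ~~ odd M) (s2 : s ^+ 2 = 1).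
Hypotheses (srs : s * r * s^-1 = r ^+ (M - 1)) (rs : s \notin <[r]>).

Let M_gt0 : 0 < M.
Proof. by have := order_gt0 r; rewrite or muln_gt0. Qed.

Lemma order_half : #[r ^+ M] = 2.
Proof. by rewrite orderXdiv or ?dvdn_mull // mulnK. Qed.

Lemma flip_notin i : r ^+ i * s \notin <[r]>.
Proof. by rewrite groupMl ?mem_cycle. Qed.

(** Moving s across r^i multiplies the exponent by M - 1, so
    (r^i s)^2 = r^(i + i(M - 1)) = r^(iM), and r^M is an involution. *)
Lemma flip_sqr i : (r ^+ i * s) ^+ 2 = if odd i then r ^+ M else 1.
Proof.
have sri : s * r ^+ i = r ^+ (i * (M - 1)) * s.
  have := conjXg r s^-1 i; rewrite !conjgE invgK !mulgA srs -expgM mulnC => <-.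
  by rewrite mulgKV.
have -> : (r ^+ i * s) ^+ 2 = r ^+ (i * M).
  rewrite [LHS]expgS expg1 -mulgA (mulgA s) sri.
  rewrite -mulgA -[s * s]/(s ^+ 2) s2 mulg1.
  by rewrite -expgD -mulnS subn1 prednK.
rewrite -{1}(odd_double_half i) mulnDl expgD -muln2 -mulnA -or.
rewrite (mulnC i./2) (expgM _ #[r]) expg_order expg1n mulg1.
by case: odd; rewrite ?mul1n.
Qed.

Lemma flip_exp4 i : (r ^+ i * s) ^+ 4 = 1.
Proof.
rewrite (expgM _ 2 2) flip_sqr; case: odd; last exact: expg1n.
by have := expg_order (r ^+ M); rewrite order_half.
Qed.

(** Here r^i s has order 4 and square r^M, so its inverse is r^M (r^i s). *)
Lemma flip_odd_inv i : odd i -> (r ^+ i * s)^-1 = r ^+ (i + M) * s.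
Proof.
move=> i_odd; apply: (mulIg (r ^+ i * s)); rewrite mulVg.
rewrite addnC expgD -(mulgA _ _ s).
have := flip_exp4 i; rewrite (expgM _ 2 2) expgS expg1.
by rewrite {1}flip_sqr i_odd expgS expg1 !mulgA.
Qed.

Lemma flip_inj i j : r ^+ i * s = r ^+ j * s -> i = j %[mod 2 * M].
Proof. by move/mulIg/eqP; rewrite eq_expg_mod_order or => /eqP. Qed.

End NonRotations.

(** * Generators from the presentation *)

(** The map x |-> x^e is its own inverse on <b>, hence an automorphism. *)
Lemma cyclic_involution (aT : finGroupType) (b : aT) e :
    e * e = 1 %[mod #[b]] ->
  exists t, [/\ t \in Aut <[b]>, #[t] %| 2 & t b = b ^+ e].
Proof.
move=> ee1; have eeK x : x \in <[b]> -> x ^+ e ^+ e = x.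
  case/cycleP=> n ->; rewrite -expgM -expgM mulnC expgM.
  by congr (_ ^+ n); apply/eqP; rewrite -[eqbRHS]expg1 eq_expg_mod_order ee1.
have injf : 'injm (cyclem e b).
  by apply/injmP=> x y bx by_ /= xy; rewrite -(eeK x) // -(eeK y) // [x ^+ e]xy.
have imf : cyclem e b @* <[b]> = <[b]>.
  by apply/morphim_fixP=> //; rewrite morphim_cycle ?cycle_id ?cycleX.
have bP := cycle_id b.
exists (aut injf imf); split; [exact: Aut_aut | | by rewrite autE].
rewrite order_dvdn; apply/eqP/(@eq_Aut _ <[b]>%G).
- by rewrite groupX ?Aut_aut.
- exact: group1.
move=> x bx; rewrite expgS expg1 permM perm1 !autE ?groupX //.
exact: eeK.
Qed.

Lemma involution_inv (gT : finGroupType) (s : gT) : s ^+ 2 = 1 -> s^-1 = s.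
Proof. by move=> s2; apply: (mulgI s); rewrite mulgV -s2 expgS expg1. Qed.

(** The semidirect product of order 2N satisfies the relations, so it is a
    quotient of any group with this presentation. *)
Lemma split_metacyclic_card N e (gT : finGroupType) :
    1 < N -> e * e = 1 %[mod N] ->
    [set: gT] \isog Grp (r : s :
      (s ^+ 2 = r ^+ N = 1, s * r * s^-1 = r ^+ e)) ->
  2 * N <= #|gT|.
Proof.
move=> N_gt1 ee1 isoG; pose rT := Extremal.gtype N 2 e.
have aut_e : exists t, [/\ t \in Aut <[Zp1 : 'Z_N]>, #[t] %| 2
                         & t (Zp1 : 'Z_N) = Zp1 ^+ e].
  by apply: cyclic_involution; rewrite order_Zp1 Zp_cast.
have homT := isoGrp_hom (Extremal.Grp (isT : 1 < 2) N_gt1 aut_e).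
rewrite -(Extremal.card e (isT : 1 < 2) N_gt1) -[#|gT|]cardsT.
apply: dvdn_leq; rewrite ?cardG_gt0 //; apply: card_homg.
rewrite (isoG _ [set: rT]%G).
case/existsP: homT => -[r s] /= /eqP[defT rN s2 rs].
apply/existsP; exists (r, s); rewrite /= !xpair_eqE defT rN s2 !eqxx /=.
by rewrite -rs conjgE !(involution_inv s2) mulgA.
Qed.

(** The generators cover at most 2 #[r] <= 2N elements, and fewer if s is in
    <r>; as there are at least 2N elements, both bounds are attained. *)
Lemma split_metacyclic_generators N e (gT : finGroupType) :
    1 < N -> e * e = 1 %[mod N] ->
    [set: gT] \isog Grp (r : s :
      (s ^+ 2 = r ^+ N = 1, s * r * s^-1 = r ^+ e)) ->
  exists r s : gT,
    [/\ #[r] = N, s ^+ 2 = 1, s * r * s^-1 = r ^+ e, s \notin <[r]>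
      & forall x, x \in <[r]> \/ exists i, x = r ^+ i * s].
Proof.
move=> N_gt1 ee1 isoG; have cardG := split_metacyclic_card N_gt1 ee1 isoG.
case/existsP: (isoGrp_hom isoG) => -[r s] /= /eqP[defG s2 rN srs].
have cover x : x \in <[r]> \/ exists i, x = r ^+ i * s.
  have : x \in <[r]> * <[s]>.
    rewrite -norm_joinEr ?defG ?inE //.
    rewrite norms_cycle conjgE {1}(involution_inv s2) mulgA.
    by rewrite -{2}(involution_inv s2) srs mem_cycle.
  case/mulsgP=> _ _ /cycleP[i ->] /cycleP[j ->] ->.
  rewrite -(odd_double_half j) -mul2n expgD (expgM s 2) s2 expg1n mulg1.
  by case: odd; [right; exists i | left; rewrite mulg1 mem_cycle].
have or_N : #[r] <= N by rewrite dvdn_leq ?order_dvdn ?rN // ltnW.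
have sub_r : [set: gT] \subset <[r]> :|: <[r]> :* s.
  apply/subsetP=> x _; rewrite inE; case: (cover x) => [-> // | [i ->]].
  by rewrite mem_rcoset mulgK mem_cycle orbT.
have card2 : #|gT| <= #|<[r]> :|: <[r]> :* s|.
  by rewrite -cardsT subset_leq_card.
exists r, s; split=> //.
  apply/eqP; rewrite eqn_leq or_N -(leq_pmul2l (isT : 0 < 2)).
  apply: leq_trans cardG (leq_trans card2 _).
  by rewrite (leq_trans (leq_card_setU _ _)) // card_rcoset addnn mul2n.
apply: contraL (leq_trans cardG card2) => rs.
rewrite rcoset_id // setUid -ltnNge.
by rewrite (leq_ltn_trans or_N) // ltn_Pmull // ltnW.
Qed.

(** * The classes of elements *)

Section Fibers.

Variables (k q : nat) (gT : finGroupType) (r s : gT).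
Hypotheses (k2 : 2 <= k) (q_pr : prime q) (q2 : q != 2).

Let M := (2 ^ (k - 1) * q)%N.

Hypotheses (or : #[r] = (2 ^ k * q)%N) (s2 : s ^+ 2 = 1).
Hypotheses (srs : s * r * s^-1 = r ^+ (M - 1)) (rs : s \notin <[r]>).
Hypothesis cover : forall x, x \in <[r]> \/ exists i, x = r ^+ i * s.

(** The vertices w_j are numbered from 1, and the j-th pair is the one
    containing r^(2j - 1) s. Since the inverse of r^i s is r^(i + M) s for odd
    i, these pairs exhaust the odd exponents as 2j - 1 runs through the odd
    numbers below M. *)
Definition gamma_fiber (v : vertex (Gamma k q)) : {set gT} :=
  if gamma_rot v then
    [set x in <[r]> | #[x] == 2 ^ (gamma_lev v).1 * q ^ (gamma_lev v).2]%N
  else if v is gw j _ then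
    let x := r ^+ j.-1.*2.+1 * s in [set x; x^-1]
  else [set r ^+ i.*2 * s | i : 'I_M].

Let or2M : #[r] = (2 * M)%N.
Proof. by rewrite or /M mulnA -expnS subn1 prednK // ltnW. Qed.

Let half_M : M = (2 ^ (k - 2) * q).*2.
Proof. by rewrite /M -mul2n mulnA -expnS -subSn. Qed.

Let evenM : ~~ odd M.
Proof. by rewrite half_M odd_double. Qed.

Let M_gt0 : 0 < M.
Proof. by have := order_gt0 r; rewrite or2M muln_gt0. Qed.

Lemma mem_fiber_rot v x : x \in gamma_fiber v -> (x \in <[r]>) = gamma_rot v.
Proof.
rewrite /gamma_fiber; case: ifP => [_ | nv]; first by rewrite inE => /andP[].
case: v nv => [||i hi||i hi|j hj|] //= _; last first.
  by case/imsetP=> i _ ->; apply/negbTE/flip_notin.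
by rewrite !inE => /orP[] /eqP->; rewrite ?groupV; apply/negbTE/flip_notin.
Qed.

Lemma order_fiber_rot v x : gamma_rot v -> x \in gamma_fiber v ->
  #[x] = (2 ^ (gamma_lev v).1 * q ^ (gamma_lev v).2)%N.
Proof. by rewrite /gamma_fiber => ->; rewrite inE => /andP[_ /eqP]. Qed.

Lemma order_sqr_fiber v x : ~~ gamma_rot v -> x \in gamma_fiber v ->
  #[x ^+ 2] = (2 ^ (gamma_lev v).1 * q ^ (gamma_lev v).2)%N.
Proof.
rewrite /gamma_fiber => /negbTE nv; rewrite nv.
case: v nv => [||i hi||i hi|j hj|] //= _; last first.
  case/imsetP=> i _ ->; rewrite (flip_sqr or2M s2 srs) odd_double order1.
  by rewrite !expn0.
rewrite !inE => /orP[] /eqP->; rewrite ?expgVn ?orderV;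
by rewrite (flip_sqr or2M s2 srs) /= odd_double (order_half or2M) // muln1.
Qed.

Lemma fiber_inv v x : ~~ gamma_rot v -> x \in gamma_fiber v ->
  x^-1 \in gamma_fiber v.
Proof.
rewrite /gamma_fiber => /negbTE nv; rewrite nv.
case: v nv => [||i hi||i hi|j hj|] //= _; last first.
  case/imsetP=> i _ ->; apply/imsetP; exists i => //.
  apply: (mulgI (r ^+ i.*2 * s)); rewrite mulgV.
  by have := flip_sqr or2M s2 srs i.*2; rewrite odd_double expgS expg1.
by rewrite !inE => /orP[] /eqP->; rewrite ?invgK eqxx ?orbT.
Qed.

Lemma sqr_rotation x : x ^+ 2 \in <[r]>.
Proof.
case: (cover x) => [rx | [i ->]]; first exact: groupX.
by rewrite (flip_sqr or2M s2 srs); case: odd; rewrite ?group1 ?mem_cycle.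
Qed.

Lemma non_rotation_exp4 x : x \notin <[r]> -> x ^+ 4 = 1.
Proof.
by case: (cover x) => [-> // | [i ->]] _; apply: (flip_exp4 or2M s2 srs).
Qed.

(** The residue modulo M of the exponent is common to both members of a pair,
    and so identifies the pair. *)
Lemma gw_exponent j hj x : x \in gamma_fiber (@gw k q j hj) ->
  exists2 i, x = r ^+ i * s & i %% M = j.-1.*2.+1.
Proof.
have j_lt : j.-1.*2.+1 < M by rewrite half_M; move: hj; lia.
rewrite !inE => /orP[] /eqP->; first by exists j.-1.*2.+1; rewrite ?modn_small.
rewrite (flip_odd_inv or2M s2 srs) /= ?odd_double //.
by exists (j.-1.*2.+1 + M)%N; rewrite // modnDr modn_small.
Qed.

(** Membership in <r> and the order of x, or of x^2 outside <r>, determine the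
    vertex, except that the pairs are told apart by [gw_exponent]. *)
Lemma gamma_fiber_disjoint v w x :
  x \in gamma_fiber v -> x \in gamma_fiber w -> v = w.
Proof.
move=> vx wx; have := mem_fiber_rot wx; rewrite (mem_fiber_rot vx) => rot_vw.
have lev_inj a b : (2 ^ a.1 * q ^ a.2 = 2 ^ b.1 * q ^ b.2)%N -> a = b.
  case: a b => [a a'] [b b'] /= ab; congr (_, _).
    by rewrite -(logn_2q q_pr q2 a a').1 ab logn_2q.
  by rewrite -(logn_2q q_pr q2 a a').2 ab logn_2q.
have [rot_v | rot_v] := boolP (gamma_rot v).
  have rot_w : gamma_rot w by rewrite -rot_vw.
  apply: gamma_rot_inj => //; apply: lev_inj.
  by rewrite -(order_fiber_rot rot_v vx) (order_fiber_rot rot_w wx).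
have rot_w : ~~ gamma_rot w by rewrite -rot_vw.
have := order_sqr_fiber rot_v vx.
rewrite (order_sqr_fiber rot_w wx) => /lev_inj.
case: v w vx wx rot_v rot_w {rot_vw} =>
  [||? ?||? ?|i hi|] [||? ?||? ?|j hj|] //=.
move=> /gw_exponent[a -> ai] /gw_exponent[b ab bj] _ _ _.
have ij : i.-1.*2.+1 = j.-1.*2.+1.
  have abM : a = b %[mod M].
    have := flip_inj or2M ab => /(congr1 (modn^~ M)).
    by rewrite !(@modn_dvdm (2 * M)) // dvdn_mull.
  by rewrite -ai -bj.
apply: gamma_code_inj => /=; congr (_, _); move: hi hj ij; lia.
Qed.

Lemma card_gamma_fiber v : #|gamma_fiber v| = gamma_size v.
Proof.
rewrite /gamma_fiber /gamma_size; case: ifP => [rot_v | nv].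
  apply: card_order_cycle; rewrite or -[q in X in _ %| X]expn1 dvdn_2q //.
  by case: v rot_v => [||i hi||i hi|i hi|] //= _; move: k2; try (move: hi); lia.
case: v nv => [||? ?||? ?|j hj|] //= _.
  rewrite cards2; set x := _ * s; suff -> : x != x^-1 by [].
  apply/eqP=> xV; have : #[x ^+ 2] = 2.
    by rewrite (flip_sqr or2M s2 srs) /= odd_double (order_half or2M).
  by rewrite expgS expg1 {2}xV mulgV order1.
rewrite card_imset ?card_ord // => i j /(flip_inj or2M).
rewrite !modn_small; try (move: (ltn_ord i) (ltn_ord j); lia).
by move=> ij; apply: val_inj => /=; lia.
Qed.

Lemma gamma_fiber_cover x : exists v, x \in gamma_fiber v.
Proof.
have [rx | rx] := boolP (x \in <[r]>).
  have := order_dvdG rx; rewrite -orderE or.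
  case/(divisor_2q q_pr)=> a [b [ak b1 ox]].
  have [v rot_v lev_v] := gamma_rot_surj q ak b1.
  by exists v; rewrite /gamma_fiber rot_v inE rx ox lev_v /=.
case: (cover x) => [/(negP rx) // | [i0 ->]] {x rx}.
rewrite -expg_mod_order or2M; set i := (i0 %% _)%N.
have i_lt : i < 2 * M by rewrite ltn_mod muln_gt0.
have [i_odd | i_even] := boolP (odd i); last first.
  exists (gz k q); apply/imsetP; have i2 : i./2 < M by lia.
  by exists (Ordinal i2); rewrite //= even_halfK.
(* Both i and its residue c are odd because M is even, so c = 2l - 1. *)
pose c := (i %% M)%N; pose l := c./2.+1.
have iE : i = c \/ i = (c + M)%N.
  have [iM | Mi] := ltnP i M; [left | right]; first by rewrite /c modn_small.
  by rewrite /c -{2}(subnK Mi) modnDr modn_small ?subnK //; lia.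
have l2 : l.-1.*2.+1 = c by case: iE i_odd evenM => ->; rewrite /l; lia.
have hl : 1 <= l <= 2 ^ (k - 2) * q.
  by have := ltn_pmod i M_gt0; rewrite -/c -l2 half_M; lia.
exists (@gw k q l hl); rewrite !inE l2.
case: iE => ->; first by rewrite eqxx.
by rewrite (flip_odd_inv or2M s2 srs) ?eqxx ?orbT // -l2 /= odd_double.
Qed.

Lemma mem_cycle_non_rotation x y : x \notin <[r]> -> y \notin <[r]> ->
  (x \in <[y]>) = (x == y) || (x == y^-1).
Proof.
move=> rx ry; apply: (@mem_cycle_odd _ <[r]>%G) => //.
  exact: sqr_rotation.
exact: non_rotation_exp4.
Qed.

Lemma power_adj_within v : {in gamma_fiber v &, forall x y,
  power_adj x y <-> gamma_full v && (x != y)}.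
Proof.
move=> x y vx vy; have rx := mem_fiber_rot vx; have ry := mem_fiber_rot vy.
have [rot_v | rot_v] := boolP (gamma_rot v).
  have -> : gamma_full v by case: (v) rot_v.
  rewrite rot_v in rx ry; split=> [/power_adjE[/eqP //] | /eqP xy].
  apply/power_adjE; split=> //; left.
  rewrite (mem_cycle_dvd (cycle_cyclic r)) //.
  by rewrite (order_fiber_rot rot_v vx) (order_fiber_rot rot_v vy).
rewrite (negbTE rot_v) in rx ry.
have xyE := mem_cycle_non_rotation (negbT rx) (negbT ry).
have yxE := mem_cycle_non_rotation (negbT ry) (negbT rx).
case: v rot_v vx vy => [||? ?||? ?|j hj|] //= _ vx vy.
  split=> [/power_adjE[/eqP //] | /eqP xy].
  apply/power_adjE; split=> //; left; rewrite xyE.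
  by move: vx vy xy; rewrite !inE => /orP[] /eqP-> /orP[] /eqP->;
     rewrite ?invgK eqxx ?orbT.
split=> // /power_adjE[xy xyV].
have invK z : z \in gamma_fiber (gz k q) -> z^-1 = z.
  move=> /(order_sqr_fiber (isT : ~~ gamma_rot (gz k q))) /= /eqP.
  by rewrite !expn0 order_eq1 => /eqP/involution_inv.
by case: xyV; rewrite (xyE, yxE) invK // orbb => /eqP // /esym.
Qed.

(** An x outside <r> in <y> forces y to be outside <r> as well; then x is y or
    y^-1, and both of these belong to the class of y. *)
Lemma mem_cycle_across v w : v != w ->
  {in gamma_fiber v & gamma_fiber w, forall x y,
    (x \in <[y]>) = gamma_below v w}.
Proof.
move=> vw x y vx wy; have rx := mem_fiber_rot vx; have ry := mem_fiber_rot wy.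
rewrite /gamma_below -(dvdn_2q q_pr q2).
have [rot_v | rot_v] := boolP (gamma_rot v).
  rewrite -(order_fiber_rot rot_v vx) /=; rewrite rot_v in rx.
  have [rot_w | rot_w] := boolP (gamma_rot w).
    rewrite -(order_fiber_rot rot_w wy); rewrite rot_w in ry.
    exact: (mem_cycle_dvd (cycle_cyclic r)).
  rewrite -(order_sqr_fiber rot_w wy); rewrite (negbTE rot_w) in ry.
  rewrite (@mem_cycle_sqr _ <[r]>%G) ?ry ?sqr_rotation //.
  by rewrite (mem_cycle_dvd (cycle_cyclic r)) ?sqr_rotation.
apply/negP=> xy; rewrite (negbTE rot_v) in rx.
have [rot_w | rot_w] := boolP (gamma_rot w).
  rewrite rot_w in ry; have := subsetP (_ : <[y]> \subset <[r]>) x xy.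
  by rewrite cycle_subG ry rx => /(_ isT).
rewrite (negbTE rot_w) in ry.
move: xy; rewrite mem_cycle_non_rotation ?rx ?ry // => /orP[] /eqP xy.
  by move/eqP: vw; apply; apply: gamma_fiber_disjoint vx _; rewrite xy.
by move/eqP: vw; apply; apply: gamma_fiber_disjoint vx _; rewrite xy fiber_inv.
Qed.

Lemma power_adj_across v w : v != w ->
  {in gamma_fiber v & gamma_fiber w, forall x y,
    power_adj x y <-> gamma_adj v w}.
Proof.
move=> vw x y vx wy; rewrite gamma_adj_below //.
have wv : w != v by rewrite eq_sym.
rewrite -(mem_cycle_across vw vx wy) -(mem_cycle_across wv wy vx).
split=> [/power_adjE[_ /orP] // | /orP xy].
apply/power_adjE; split=> // def_x.
by move/eqP: vw; apply; apply: gamma_fiber_disjoint vx _; rewrite def_x.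
Qed.

End Fibers.

Theorem proposition3p1 (k q : nat) (hk : (2 <= k)%N)
    (hq : prime q) (hq2 : q <> 2)
    (gT : finGroupType)
    (hG : [set: gT] \isog Grp (r : s :
       (s ^+ 2 = r ^+ (2 ^ k * q)%N = 1,
        s * r * s^-1 = r ^+ (2 ^ (k - 1) * q - 1)%N))) :
  graph_iso (power_graph gT) (joined_union (@gamma_blocks k q)).
Proof.
have q2 : q != 2 by apply/eqP.
have N_gt1 : 1 < 2 ^ k * q.
  exact: leq_trans (prime_gt1 hq) (leq_pmull _ (expn_gt0 2 k)).
have ee1 := half_pred_sqr hk (prime_gt0 hq).
have [r [s [or s2 srs rs cover]]] := split_metacyclic_generators N_gt1 ee1 hG.
apply: (@joined_union_of_fibers _ _ _ _ (Gamma k q) _ (@gamma_size k q)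
  (@gamma_full k q) (@gamma_fiber k q gT r s)).
- exact: gamma_blocksE.
- exact: card_gamma_fiber.
- exact: gamma_fiber_cover.
- exact: gamma_fiber_disjoint.
- exact: power_adj_within.
exact: power_adj_across.
Qed.
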